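(* Let $\{A,B,C\}\subset S^{1,1}$ be a tempolateral de Sitter triangle such that the first components of the tangent vectors $X_{AB}$ and $X_{AC}$ at $A$ have different signs. Let $a,b,c$ be the side lengths opposite $A,B,C$ and $\alpha,\beta,\gamma$ the angles at $A,B,C$. Then $$\cosh(\alpha)=\cosh(\beta)\cosh(\gamma)+\cosh(a)\sinh(\beta)\sinh(\gamma),$$ $$\cosh(\beta)=\cosh(\alpha)\cosh(\gamma)-\cosh(b)\sinh(\alpha)\sinh(\gamma),$$ $$\cosh(\gamma)=\cosh(\alpha)\cosh(\beta)-\cosh(c)\sinh(\alpha)\sinh(\beta).$$
   Context: On $\mathbb{R}^3$ let $\langle\langle x,y\rangle\rangle=-x_1y_1+x_2y_2+x_3y_3$, $|||x|||=\sqrt{|\langle\langle x,x\rangle\rangle|}$, and let $\times$ be the Euclidean cross product. $S^{1,1}=\{x:\langle\langle x,x\rangle\rangle=1\}$. For distinct $A,B\in S^{1,1}$, the side between $A$ and $B$ is timelike if $A-B$ is timelike, i.e. $\langle\langle A-B,A-B\rangle\rangle<0$ (equivalently $\langle\langle A,B\rangle\rangle>1$; $A$ and $B$ lie on the same branch of a great hyperbola). Its length is then $\operatorname{arcosh}(\langle\langle A,B\rangle\rangle)$, and the unit tangent vector at $A$ towards $B$ is $X_{AB}=\dfrac{B-\langle\langle A,B\rangle\rangle A}{|||A\times B|||}$. A tempolateral triangle is a set of three distinct points $\{A,B,C\}\subset S^{1,1}$ all of whose sides are timelike. Side lengths: $a$ between $B$ and $C$, $b$ between $A$ and $C$, $c$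 between $A$ and $B$. The angle at $A$ is $\alpha=\operatorname{arcosh}(|\langle\langle X_{AB},X_{AC}\rangle\rangle|)\ge0$, and analogously $\beta$ at $B$, $\gamma$ at $C$. ''First component'' means the $x_1$-coordinate. *)

(* Defs.v *)
From Stdlib Require Import Reals Lra Psatz.
From Coquelicot Require Import Coquelicot.

Open Scope R_scope.

(* Vector operations on [R3] ([plus], [minus], [scal]) are those of Coquelicot's
   product module structure. *)
Definition R3 : Type := (R * R * R)%type.

Definition x1 (v : R3) : R := fst (fst v).
Definition x2 (v : R3) : R := snd (fst v).
Definition x3 (v : R3) : R := snd v.

Definition mink (x y : R3) : R := - x1 x * x1 y + x2 x * x2 y + x3 x * x3 y.

Definition mnorm (x : R3) : R := sqrt (Rabs (mink x x)).

Definition cross (x y : R3) : R3 :=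
  (x2 x * x3 y - x3 x * x2 y,
   x3 x * x1 y - x1 x * x3 y,
   x1 x * x2 y - x2 x * x1 y).

(* Membership in S^{1,1}. *)
Definition deSitter (x : R3) : Prop := mink x x = 1.

Definition timelike (v : R3) : Prop := mink v v < 0.

(* Meaningful for [1 <= x] only: see [cosh_arcosh] and [arcosh_ge0]. *)
Definition arcosh (x : R) : R := ln (x + sqrt (x ^ 2 - 1)).

Lemma arcosh_ge0 (x : R) : 1 <= x -> 0 <= arcosh x.
Proof.
intros Hx; unfold arcosh; rewrite <- ln_1.
pose proof (sqrt_pos (x ^ 2 - 1)).
apply ln_le; lra.
Qed.

Lemma cosh_arcosh (x : R) : 1 <= x -> cosh (arcosh x) = x.
Proof.
intros Hx; unfold cosh, arcosh.
assert (Hs := sqrt_pos (x ^ 2 - 1)).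
assert (Hq : sqrt (x ^ 2 - 1) * sqrt (x ^ 2 - 1) = x ^ 2 - 1)
  by (apply sqrt_sqrt; nra).
rewrite exp_Ropp, exp_ln by lra.
apply Rmult_eq_reg_r with (2 * (x + sqrt (x ^ 2 - 1))); [|lra].
field_simplify; [nra|lra].
Qed.

Definition side_length (A B : R3) : R := arcosh (mink A B).

(* X_AB: based at [A], pointing towards [B]. *)
Definition tangent (A B : R3) : R3 :=
  scal (/ mnorm (cross A B)) (minus B (scal (mink A B) A)).

(* The vertex is the first argument. *)
Definition angle (A B C : R3) : R :=
  arcosh (Rabs (mink (tangent A B) (tangent A C))).

Definition tempolateral (A B C : R3) : Prop :=
  (deSitter A /\ deSitter B /\ deSitter C) /\
  (A <> B /\ A <> C /\ B <> C) /\
  (timelike (minus A B) /\ timelike (minus A C) /\ timelike (minus B C)).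

Definition different_signs (s t : R) : Prop :=
  (0 < s /\ t < 0) \/ (s < 0 /\ 0 < t).

(* Main.v *)
Require Import Defs.
From Stdlib Require Import Reals Lra Psatz.
From Coquelicot Require Import Coquelicot.

Open Scope R_scope.

(** Put [p = <<B,C>>], [q = <<A,C>>], [r = <<A,B>>], all greater than 1.  Then
    [<<X_AB,X_AC>> = (p - q r) / (sinh b sinh c)], and cyclically.  The opposite
    time orientations of [X_AB] and [X_AC] give [p > q r], hence [p r > q] and
    [p q > r], which fixes the sign inside every absolute value.  The Gram
    determinant of [A, B, C] is [- D], where
    [D = p^2 + q^2 + r^2 - 2 p q r - 1 = det(A,B,C)^2 >= 0],
    so [sinh alpha = sqrt D / (sinh b sinh c)] and cyclically, and the three
    formulas become polynomial identities in [p, q, r]. *)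

Lemma sinh_arcosh (x : R) : 1 <= x -> sinh (arcosh x) = sqrt (x ^ 2 - 1).
Proof.
intros Hx; unfold sinh, arcosh.
assert (Hs := sqrt_pos (x ^ 2 - 1)).
assert (Hq : sqrt (x ^ 2 - 1) * sqrt (x ^ 2 - 1) = x ^ 2 - 1)
  by (apply sqrt_sqrt; nra).
rewrite exp_Ropp, exp_ln by lra.
apply Rmult_eq_reg_r with (2 * (x + sqrt (x ^ 2 - 1))); [|lra].
field_simplify; [nra|lra].
Qed.

(** Meant for [s] a product of two hyperbolic sines of sides and [d] the Gram defect. The relation
    [t ^ 2 = s ^ 2 + d] yields both [1 <= t / s] and [(t / s) ^ 2 - 1 = d / s ^ 2]. *)
Lemma arcosh_quotient (t s d : R) :
  0 <= t -> 0 < s -> 0 <= d -> t ^ 2 = s ^ 2 + d ->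
  cosh (arcosh (t / s)) = t / s /\ sinh (arcosh (t / s)) = sqrt d / s.
Proof.
intros Ht Hs Hd H.
assert (H1 : 1 <= t / s).
{ apply Rmult_le_reg_r with s; [lra|].
  unfold Rdiv; rewrite Rmult_assoc, Rinv_l by lra; nra. }
split; [now apply cosh_arcosh|].
rewrite sinh_arcosh by exact H1.
replace ((t / s) ^ 2 - 1) with (d / s ^ 2)
  by (replace d with (t ^ 2 - s ^ 2) by lra; field; lra).
rewrite sqrt_div_alt by nra.
now rewrite sqrt_pow2 by lra.
Qed.

Lemma mink_sym (u v : R3) : mink u v = mink v u.
Proof. unfold mink; ring. Qed.

(** Lagrange's identity, with the sign opposite to the Euclidean one because of the signature. *)
Lemma mink_cross (u v : R3) :
  mink (cross u v) (cross u v) = mink u v ^ 2 - mink u u * mink v v.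
Proof. unfold mink, cross, x1, x2, x3; simpl; ring. Qed.

Lemma mink_scal_l (k : R) (u v : R3) : mink (scal k u) v = k * mink u v.
Proof.
unfold mink, x1, x2, x3, scal; simpl; unfold scal; simpl; unfold mult; simpl.
ring.
Qed.

Lemma mink_minus_l (u v w : R3) : mink (minus u v) w = mink u w - mink v w.
Proof.
unfold mink, x1, x2, x3, minus, plus, opp; simpl.
unfold plus, opp; simpl.
ring.
Qed.

Lemma mink_scal_r (k : R) (u v : R3) : mink u (scal k v) = k * mink u v.
Proof. now rewrite mink_sym, mink_scal_l, mink_sym. Qed.

Lemma mink_minus_r (u v w : R3) : mink u (minus v w) = mink u v - mink u w.
Proof. now rewrite mink_sym, mink_minus_l, (mink_sym v), (mink_sym w). Qed.

(** Timelike vectors have time components that dominate the spatial ones, so by planar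
    Cauchy-Schwarz the term [- x1 u * x1 v] decides the sign of the product. *)
Lemma mink_timelike_opposite_pos (u v : R3) :
  timelike u -> timelike v -> different_signs (x1 u) (x1 v) -> 0 < mink u v.
Proof.
unfold timelike, mink; intros Hu Hv Hs.
assert (Hn : 0 < - x1 u * x1 v) by (destruct Hs; nra).
enough (- (x2 u * x2 v + x3 u * x3 v) < - x1 u * x1 v) by lra.
apply Rnot_le_lt; intros Hle.
assert (Hsq : (x1 u * x1 v) ^ 2 <= (x2 u * x2 v + x3 u * x3 v) ^ 2) by nra.
assert (Hcs : (x2 u * x2 v + x3 u * x3 v) ^ 2
              <= (x2 u ^ 2 + x3 u ^ 2) * (x2 v ^ 2 + x3 v ^ 2))
  (* This square is exactly the deficit in the planar Cauchy-Schwarz inequality. *)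
  by (pose proof (pow2_ge_0 (x2 u * x3 v - x3 u * x2 v)); nra).
assert (Hlt : (x2 u ^ 2 + x3 u ^ 2) * (x2 v ^ 2 + x3 v ^ 2)
              < x1 u ^ 2 * x1 v ^ 2) by (apply Rmult_le_0_lt_compat; nra).
nra.
Qed.

Lemma timelike_side_mink_gt1 (A B : R3) :
  deSitter A -> deSitter B -> timelike (minus A B) -> 1 < mink A B.
Proof.
unfold deSitter, timelike; intros HA HB H.
rewrite mink_minus_l, !mink_minus_r, (mink_sym B A), HA, HB in H; lra.
Qed.

Lemma mnorm_cross (A B : R3) :
  deSitter A -> deSitter B -> 1 < mink A B ->
  mnorm (cross A B) = sqrt (mink A B ^ 2 - 1).
Proof.
unfold deSitter; intros HA HB H.
unfold mnorm; rewrite mink_cross, HA, HB, Rabs_pos_eq by nra.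
f_equal; ring.
Qed.

(** With [r = mink A B], the vector [B - r A] has square [1 - r ^ 2 < 0], and a nonzero rescaling
    keeps the sign. *)
Lemma timelike_tangent (A B : R3) :
  deSitter A -> deSitter B -> 1 < mink A B -> timelike (tangent A B).
Proof.
intros HA HB H.
unfold timelike, tangent; rewrite mnorm_cross by assumption.
unfold deSitter in *.
rewrite mink_scal_l, mink_scal_r, mink_minus_l, !mink_minus_r,
  !mink_scal_l, !mink_scal_r, (mink_sym B A), HA, HB.
assert (Hi : 0 < / sqrt (mink A B ^ 2 - 1))
  by (apply Rinv_0_lt_compat, sqrt_lt_R0; nra).
set (k := / sqrt (mink A B ^ 2 - 1)) in *; clearbody k.
assert (0 < k * k * (mink A B ^ 2 - 1)) by (apply Rmult_lt_0_compat; nra).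
lra.
Qed.

Lemma mink_tangent (A B C : R3) :
  deSitter A -> deSitter B -> deSitter C -> 1 < mink A B -> 1 < mink A C ->
  mink (tangent A B) (tangent A C) =
  (mink B C - mink A B * mink A C)
  / (sqrt (mink A B ^ 2 - 1) * sqrt (mink A C ^ 2 - 1)).
Proof.
intros HA HB HC Hr Hq.
unfold tangent; rewrite !mnorm_cross by assumption.
rewrite mink_scal_l, mink_scal_r, mink_minus_l, !mink_minus_r,
  !mink_scal_l, !mink_scal_r, (mink_sym B A), HA.
assert (0 < sqrt (mink A B ^ 2 - 1)) by (apply sqrt_lt_R0; nra).
assert (0 < sqrt (mink A C ^ 2 - 1)) by (apply sqrt_lt_R0; nra).
field; lra.
Qed.

Definition gram_defect (A B C : R3) : R :=
  mink A B ^ 2 + mink A C ^ 2 + mink B C ^ 2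
  - 2 * mink A B * mink A C * mink B C - 1.

Lemma gram_defect_ge0 (A B C : R3) :
  deSitter A -> deSitter B -> deSitter C -> 0 <= gram_defect A B C.
Proof.
unfold deSitter; intros HA HB HC.
(* The base of the square is the triple product, that is, the determinant of [A], [B], [C]. *)
replace (gram_defect A B C) with
  ((x1 A * x1 (cross B C) + x2 A * x2 (cross B C) + x3 A * x3 (cross B C)) ^ 2).
{ apply pow2_ge_0. }
(* Homogenized to degree 2 in each vector, the defect equals the squared determinant for all
   vectors, so [ring] applies before the norms are set to 1. *)
transitivity
  (mink A B ^ 2 * mink C C + mink A C ^ 2 * mink B B + mink B C ^ 2 * mink A A
   - 2 * mink A B * mink A C * mink B C - mink A A * mink B B * mink C C).
{ unfold mink, cross, x1, x2, x3; simpl; ring. }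
unfold gram_defect; rewrite HA, HB, HC; ring.
Qed.

Lemma cosh_sinh_angle (A B C : R3) :
  deSitter A -> deSitter B -> deSitter C -> 1 < mink A B -> 1 < mink A C ->
  let s := sqrt (mink A B ^ 2 - 1) * sqrt (mink A C ^ 2 - 1) in
  cosh (angle A B C) = Rabs (mink B C - mink A B * mink A C) / s /\
  sinh (angle A B C) = sqrt (gram_defect A B C) / s.
Proof.
intros HA HB HC Hr Hq s.
assert (Hs : 0 < s) by (apply Rmult_lt_0_compat; apply sqrt_lt_R0; nra).
unfold angle; rewrite mink_tangent by assumption; fold s.
rewrite Rabs_div, (Rabs_pos_eq s) by lra.
apply arcosh_quotient.
- apply Rabs_pos.
- exact Hs.
- now apply gram_defect_ge0.
(* With [p], [q], [r] as above: [(p - r q)^2 = (r^2 - 1)(q^2 - 1) + D]. *)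
- rewrite pow2_abs; unfold s, gram_defect.
  rewrite Rpow_mult_distr, !pow2_sqrt by nra.
  ring.
Qed.

Theorem theorem5p9 (A B C : R3)
  (hT : tempolateral A B C)
  (hS : different_signs (x1 (tangent A B)) (x1 (tangent A C))) :
  let a := side_length B C in
  let b := side_length A C in
  let c := side_length A B in
  let alpha := angle A B C in
  let beta := angle B A C in
  let gamma := angle C A B in
  cosh alpha = cosh beta * cosh gamma + cosh a * sinh beta * sinh gamma /\
  cosh beta = cosh alpha * cosh gamma - cosh b * sinh alpha * sinh gamma /\
  cosh gamma = cosh alpha * cosh beta - cosh c * sinh alpha * sinh beta.
Proof.
intros a b c alpha beta gamma.
destruct hT as [[HA [HB HC]] [_ [TAB [TAC TBC]]]].
assert (Hr := timelike_side_mink_gt1 A B HA HB TAB).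
assert (Hq := timelike_side_mink_gt1 A C HA HC TAC).
assert (Hp := timelike_side_mink_gt1 B C HB HC TBC).
assert (Hpos := mink_timelike_opposite_pos _ _
  (timelike_tangent A B HA HB Hr) (timelike_tangent A C HA HC Hq) hS).
rewrite mink_tangent in Hpos by assumption.
assert (Ha : cosh a = mink B C) by (apply cosh_arcosh; lra).
assert (Hb : cosh b = mink A C) by (apply cosh_arcosh; lra).
assert (Hc : cosh c = mink A B) by (apply cosh_arcosh; lra).
destruct (cosh_sinh_angle A B C) as [Ca Sa]; try assumption.
destruct (cosh_sinh_angle B A C) as [Cb Sb]; try assumption.
{ now rewrite mink_sym. }
destruct (cosh_sinh_angle C A B) as [Cc Sc]; try assumption.
{ now rewrite mink_sym. }
{ now rewrite mink_sym. }
fold alpha in Ca, Sa; fold beta in Cb, Sb; fold gamma in Cc, Sc.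
assert (HD := gram_defect_ge0 A B C HA HB HC).
assert (EB : gram_defect B A C = gram_defect A B C)
  by (unfold gram_defect; rewrite (mink_sym B A); ring).
assert (EC : gram_defect C A B = gram_defect A B C)
  by (unfold gram_defect; rewrite (mink_sym C A), (mink_sym C B); ring).
rewrite EB in Sb; rewrite EC in Sc.
rewrite (mink_sym B A) in Cb, Sb.
rewrite (mink_sym C A), (mink_sym C B) in Cc, Sc.
assert (HDe : sqrt (gram_defect A B C) ^ 2 = gram_defect A B C)
  by (now apply pow2_sqrt).
(* The occurrence under the root stays folded, to be abstracted as [d] below. *)
unfold gram_defect in HDe at 2.
rewrite Ca, Sa, Cb, Sb, Cc, Sc, Ha, Hb, Hc.
clear - Hr Hq Hp Hpos HDe.
set (d := sqrt (gram_defect A B C)) in *; clearbody d.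
set (r := mink A B) in *; set (q := mink A C) in *; set (p := mink B C) in *.
clearbody p q r.
assert (Pp : 0 < sqrt (p ^ 2 - 1)) by (apply sqrt_lt_R0; nra).
assert (Pq : 0 < sqrt (q ^ 2 - 1)) by (apply sqrt_lt_R0; nra).
assert (Pr : 0 < sqrt (r ^ 2 - 1)) by (apply sqrt_lt_R0; nra).
assert (Sp : sqrt (p ^ 2 - 1) ^ 2 = p ^ 2 - 1) by (apply pow2_sqrt; nra).
assert (Sq : sqrt (q ^ 2 - 1) ^ 2 = q ^ 2 - 1) by (apply pow2_sqrt; nra).
assert (Sr : sqrt (r ^ 2 - 1) ^ 2 = r ^ 2 - 1) by (apply pow2_sqrt; nra).
set (sp := sqrt (p ^ 2 - 1)) in *; set (sq := sqrt (q ^ 2 - 1)) in *;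
set (sr := sqrt (r ^ 2 - 1)) in *; clearbody sp sq sr.
assert (Hpqr : 0 < p - r * q).
{ replace (p - r * q) with ((p - r * q) / (sr * sq) * (sr * sq))
    by (field; lra).
  apply Rmult_lt_0_compat; [exact Hpos | nra]. }
(* From [p > r q] and [r > 1]: [r p > r^2 q > q]; likewise for the next bound. *)
assert (Hqr : q < r * p) by nra.
assert (Hrq : r < q * p) by nra.
rewrite (Rabs_pos_eq (p - r * q)), (Rabs_left1 (q - r * p)),
  (Rabs_left1 (r - q * p)) by lra.
repeat split.
(* Over a common denominator the claim is [(p - r q)(p^2 - 1) = (r p - q)(q p - r) + p D]. *)
- transitivity ((p - r * q) * sp ^ 2 / (sr * sq * sp ^ 2)); [field; lra|].
  transitivity (((r * p - q) * (q * p - r) + p * d ^ 2) / (sr * sq * sp ^ 2));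
    [|field; lra].
  rewrite HDe, Sp; f_equal; ring.
(* The same identity with the roles permuted; exactly one of the two factors in the product now has
   its sign reversed by the absolute value, as does the left side, so the [D] term becomes
   negative. *)
- transitivity ((r * p - q) * sq ^ 2 / (sr * sp * sq ^ 2)); [field; lra|].
  transitivity (((p - r * q) * (q * p - r) - q * d ^ 2) / (sr * sp * sq ^ 2));
    [|field; lra].
  rewrite HDe, Sq; f_equal; ring.
- transitivity ((q * p - r) * sr ^ 2 / (sq * sp * sr ^ 2)); [field; lra|].
  transitivity (((p - r * q) * (r * p - q) - r * d ^ 2) / (sq * sp * sr ^ 2));
    [|field; lra].
  rewrite HDe, Sr; f_equal; ring.
Qed.
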